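(* Let $\mathcal{X}$ be a compact metric space with a finite Borel measure $\mu$, and let $\boldsymbol{k}(\mathbf{x},\mathbf{z})=\sum_{k=1}^\infty \lambda_k\Phi_k(\mathbf{x})\Phi_k(\mathbf{z})$ be a positive definite (Mercer) kernel on $\mathcal{X}$, where $\lambda_k$ and $\Phi_k$ are the eigenvalues and ($L^2_\mu$-orthonormal) eigenfunctions of its integral operator. Let $g:\mathbb{R}\to\mathbb{R}$ be non-negative and $L$-Lipschitz, and let $\boldsymbol{k}_g(\mathbf{x},\mathbf{z}):=\sum_{k=1}^\infty g(\lambda_k)\Phi_k(\mathbf{x})\Phi_k(\mathbf{z})$ be the associated Modified Spectrum Kernel. Assume there is $M$ with $|\Phi_i(\mathbf{x})|\le M$ for all $i$ and all $\mathbf{x}\in\mathcal{X}$. Let $\mathbf{x}_1,\dots,\mathbf{x}_n\in\mathcal{X}$ be i.i.d. samples drawn from $\mu$, and let $K,K_g\in\mathbb{R}^{n\times n}$ be the kernel matrices $K_{ij}=\frac1n\boldsymbol{k}(\mathbf{x}_i,\mathbf{x}_j)$, $(K_g)_{ij}=\frac1n\boldsymbol{k}_g(\mathbf{x}_i,\mathbf{x}_j)$. Define $\tilde K_g=VDV^T$, where $V=(\mathbf{v}_1,\dots,\mathbf{v}_n)$ with $\mathbf{v}_i$ the $i$-th (unit) eigenvector of $K$, and $D$ is diagonal with $D_{ii}=g(\hat\lambda_i)$, $\hat\lambda_i$ being the $i$-th eigenvalue of $K$. Then, as $n\to\infty$, $$\|\tilde K_g-K_g\|_F\to 0\quad\text{almost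 surely.}$$
   Context: For a positive definite kernel $\boldsymbol{k}$ on $\mathcal{X}$, its integral operator $L_{\boldsymbol{k}}f(\mathbf{x})=\int_{\mathcal{X}}\boldsymbol{k}(\mathbf{x},\mathbf{z})f(\mathbf{z})\,d\mu(\mathbf{z})$ is compact, positive and self-adjoint on $L^2_\mu(\mathcal{X})$, with eigen-decomposition $L_{\boldsymbol{k}}\Phi_i=\lambda_i\Phi_i$, and by Mercer's theorem $\boldsymbol{k}(\mathbf{x},\mathbf{z})=\sum_i\lambda_i\Phi_i(\mathbf{x})\Phi_i(\mathbf{z})$. The Modified Spectrum Kernel $\boldsymbol{k}_g$ has the same eigenfunctions as $\boldsymbol{k}$ with eigenvalues $g(\lambda_k)$ (assumed to define a Mercer kernel). The eigenvalues of $K$ are listed together with a corresponding orthonormal eigenbasis $\mathbf{v}_1,\dots,\mathbf{v}_n$.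
   Formalization: The finite Borel measure μ is taken to be a probability measure: samples can be drawn from μ only if μ(X)=1, and if they are drawn from the normalized μ/μ(X) with μ(X)≠1 the claim fails in general. *)

(* Defs.v *)
From HB Require Import structures.
From mathcomp Require Import all_boot all_order all_algebra.
From mathcomp Require Import all_classical all_reals all_analysis.
Set Implicit Arguments. Unset Strict Implicit. Unset Printing Implicit Defensive.
Import Order.TTheory GRing.Theory Num.Theory.
Import numFieldNormedType.Exports.
Local Open Scope classical_set_scope.
Local Open Scope ring_scope.

(* Metric spaces equipped with a distinguished point (needed by the library's
   generated-sigma-algebra construction; harmless: a probability space is
   nonempty). *)
#[short(type="pointedMetricType")]
HB.structure Definition PointedMetric (K : numDomainType) :=
  { M of Metric K M & isPointed M }.

Notation borelT X := (g_sigma_algebraType (@open X)).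

Definition mercer_kernel {R : realType} (X : pointedMetricType R) (k : X -> X -> R) :=
  [/\ continuous (fun p : X * X => k p.1 p.2),
      (forall x z, k x z = k z x) &
      (forall (m : nat) (xs : 'I_m -> X) (c : 'I_m -> R),
          0 <= \sum_(i < m) \sum_(j < m) c i * c j * k (xs i) (xs j))].

Definition mutually_independent {R : realType} {d dT}
    (Omega : measurableType d) (P : probability Omega R) (T : measurableType dT)
    (Xs : nat -> Omega -> T) :=
  forall (J : seq nat) (A : nat -> set T), uniq J ->
    (forall j, j \in J -> measurable (A j)) ->
    P (\bigcap_(j in [set j | j \in J]) (Xs j @^-1` A j)) =
    (\prod_(j <- J) P (Xs j @^-1` A j))%E.

Definition kernel_matrix {R : realType} {T : Type} (k : T -> T -> R) (n : nat)
    (xs : 'I_n -> T) : 'M[R]_n :=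
  \matrix_(i < n, j < n) (n%:R^-1 * k (xs i) (xs j)).

Definition eigendecomposition {R : realType} (n : nat) (A V : 'M[R]_n)
    (lh : 'I_n -> R) :=
  V^T *m V = 1%:M /\ forall i : 'I_n, A *m col i V = lh i *: col i V.

Definition spectral_modify {R : realType} (n : nat) (g : R -> R) (V : 'M[R]_n)
    (lh : 'I_n -> R) : 'M[R]_n :=
  V *m diag_mx (\row_i g (lh i)) *m V^T.

Definition frobenius {R : realType} (m n : nat) (A : 'M[R]_(m, n)) : R :=
  Num.sqrt (\sum_(i < m) \sum_(j < n) A i j ^+ 2).

(* Main.v *)
Require Import Defs.
From HB Require Import structures.
From mathcomp Require Import all_boot all_order all_algebra.
From mathcomp Require Import all_classical all_reals all_analysis.
From mathcomp Require Import measurable_realfun.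
From mathcomp Require Import ring lra zify.
Import Order.TTheory GRing.Theory Num.Theory.
Import numFieldNormedType.Exports.
Local Open Scope classical_set_scope.
Local Open Scope ring_scope.

(* The n x m matrix F with entries Phi_j(x_i) / sqrt n has F^T F -> I almost surely
   by the strong law of large numbers, while K and K_g are within the tails of
   sum lam_i and sum g(lam_i), uniformly in n, of F Lam F^T and F g(Lam) F^T.
   Hence F almost intertwines K with Lam. In an eigenbasis of K the Lipschitz
   condition gives ||g(K) F - F g(Lam)|| <= L ||K F - F Lam|| for the Frobenius
   norm, and, since g 0 = 0, also ||g(K) (I - F F^T)|| <= L ||K (I - F F^T)||; these
   two bounds put g(K) close to F g(Lam) F^T, hence to K_g. *)

(** * Frobenius geometry and spectral perturbation of matrices *)

Section FrobeniusInnerProduct.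
Set Implicit Arguments.
Unset Strict Implicit.
Context {R : realType}.

(** The Frobenius inner product in trace form, so that adjoints move across it by associativity;
    [fro2] is the squared norm. *)
Definition mdot {m n : nat} (A B : 'M[R]_(m, n)) : R := \tr (A *m B^T).

Definition fro2 {m n : nat} (A : 'M[R]_(m, n)) : R := mdot A A.

Lemma mdotE m n (A B : 'M[R]_(m, n)) :
  mdot A B = \sum_(i < m) \sum_(j < n) A i j * B i j.
Proof.
rewrite /mdot /mxtrace; apply: eq_bigr => i _; rewrite mxE.
by apply: eq_bigr => j _; rewrite mxE.
Qed.

Lemma fro2E m n (A : 'M[R]_(m, n)) :
  fro2 A = \sum_(i < m) \sum_(j < n) A i j ^+ 2.
Proof.
rewrite /fro2 mdotE; apply: eq_bigr => i _; apply: eq_bigr => j _.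
by rewrite expr2.
Qed.

Lemma fro2_ge0 m n (A : 'M[R]_(m, n)) : 0 <= fro2 A.
Proof. by rewrite fro2E; do 2 (apply: sumr_ge0 => ? _); exact: sqr_ge0. Qed.

Lemma fro2_tr m n (A : 'M[R]_(m, n)) : fro2 A^T = fro2 A.
Proof. by rewrite /fro2 /mdot trmxK mxtrace_mulC. Qed.

Lemma fro2N m n (A : 'M[R]_(m, n)) : fro2 (- A) = fro2 A.
Proof. by rewrite /fro2 /mdot linearN /= mulmxN mulNmx opprK. Qed.

Lemma mdotC m n (A B : 'M[R]_(m, n)) : mdot A B = mdot B A.
Proof. by rewrite /mdot -mxtrace_tr trmx_mul trmxK. Qed.

Lemma mdot_mulmxl m n p (A : 'M[R]_(m, n)) (B : 'M[R]_(n, p))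
  (C : 'M[R]_(m, p)) : mdot (A *m B) C = mdot A (C *m B^T).
Proof. by rewrite /mdot trmx_mul trmxK mulmxA. Qed.

Lemma mdotDl m n (A B C : 'M[R]_(m, n)) :
  mdot (A + B) C = mdot A C + mdot B C.
Proof. by rewrite /mdot mulmxDl linearD. Qed.

Lemma fro2D_le m n (A B : 'M[R]_(m, n)) :
  fro2 (A + B) <= 2 * (fro2 A + fro2 B).
Proof.
rewrite !fro2E -big_split mulr_sumr /=; apply: ler_sum => i _.
rewrite -big_split mulr_sumr /=; apply: ler_sum => j _; rewrite mxE.
have := sqr_ge0 (A i j - B i j); lra.
Qed.

(** Weighted Young inequality, entrywise from (c a - b)^2 >= 0. The weights 1 and 2 serve to bound
    multiplication by F^T and by F. *)
Lemma mdot_le m n (A B : 'M[R]_(m, n)) (c : R) : 0 < c ->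
  2 * mdot A B <= c * fro2 A + c^-1 * fro2 B.
Proof.
move=> c0; rewrite mdotE !fro2E !mulr_sumr -big_split /=.
apply: ler_sum => i _; rewrite !mulr_sumr -big_split /=; apply: ler_sum => j _.
rewrite -subr_ge0 (_ : _ - _ = c^-1 * (c * A i j - B i j) ^+ 2).
  by rewrite mulr_ge0 ?sqr_ge0 // invr_ge0 ltW.
by field; rewrite gt_eqF.
Qed.

(** Lagrange's identity: the sum over i, j of (x_i y_j - x_j y_i)^2 equals 2 (a b - c^2). *)
Lemma sum_cauchy_schwarz (I : finType) (x y : I -> R) :
  (\sum_i x i * y i) ^+ 2 <= (\sum_i x i ^+ 2) * (\sum_i y i ^+ 2).
Proof.
set a := \sum_i x i ^+ 2; set b := \sum_i y i ^+ 2; set c := \sum_i x i * y i.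
have inner i : \sum_j (x i * y j - x j * y i) ^+ 2 =
    b * x i ^+ 2 + a * y i ^+ 2 - 2 * c * (x i * y i).
  rewrite /a /b /c mulr_sumr !mulr_suml -big_split -sumrB /=.
  by apply: eq_bigr => j _; ring.
have : 0 <= \sum_i \sum_j (x i * y j - x j * y i) ^+ 2.
  by do 2 (apply: sumr_ge0 => ? _); exact: sqr_ge0.
under eq_bigr do rewrite inner.
rewrite sumrB big_split -!mulr_sumr /= -/a -/b -/c; lra.
Qed.

Lemma fro2M_le m n p (A : 'M[R]_(m, n)) (B : 'M[R]_(n, p)) :
  fro2 (A *m B) <= fro2 A * fro2 B.
Proof.
rewrite -(fro2_tr B) !fro2E mulr_suml; apply: ler_sum => i _.
rewrite mulr_sumr; apply: ler_sum => j _; rewrite mxE.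
apply: le_trans (sum_cauchy_schwarz _ _) _.
by under [X in _ <= _ * X]eq_bigr do rewrite mxE.
Qed.

Lemma fro2_orthogonal_mul n m (V : 'M[R]_n) (A : 'M[R]_(n, m)) :
  V^T *m V = 1%:M -> fro2 (V^T *m A) = fro2 A.
Proof.
move=> /mulmx1C VV1; rewrite -(fro2_tr (_ *m _)) trmx_mul trmxK.
by rewrite /fro2 mdot_mulmxl -mulmxA VV1 mulmx1 -/(fro2 _) fro2_tr.
Qed.

Lemma eigendecompositionE n (A V : 'M[R]_n) (lh : 'I_n -> R) :
  eigendecomposition A V lh -> A = V *m diag_mx (\row_i lh i) *m V^T.
Proof.
move=> [VV1 AV]; rewrite -[LHS]mulmx1 -(mulmx1C VV1) mulmxA; congr (_ *m _).
apply/matrixP => i j; rewrite mul_mx_diag !mxE.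
have := AV j => /matrixP/(_ i ord0); rewrite !mxE mulrC => <-.
by apply: eq_bigr => l _; rewrite !mxE.
Qed.

(* In the eigenbasis of [A] the left-hand matrix is obtained from the right-hand
   one by multiplying its entries by the divided differences of [g]. *)
Lemma spectral_modify_lipschitz (g : R -> R) (L : R) n m (A V : 'M[R]_n)
    (lh : 'I_n -> R) (b : 'I_m -> R) (B : 'M[R]_(n, m)) :
  (forall s t, `|g s - g t| <= L * `|s - t|) ->
  eigendecomposition A V lh ->
  fro2 (spectral_modify g V lh *m B - B *m diag_mx (\row_j g (b j))) <=
  L ^+ 2 * fro2 (A *m B - B *m diag_mx (\row_j b j)).
Proof.
move=> gL eigA; have VV1 := eigA.1.
rewrite (eigendecompositionE eigA) /spectral_modify.
(* Stated for every [h], to be used both with [g] and with the identity, which gives back [A]. *)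
have eigbasis (h : R -> R) :
    V^T *m (V *m diag_mx (\row_i h (lh i)) *m V^T *m B
            - B *m diag_mx (\row_j h (b j))) =
    diag_mx (\row_i h (lh i)) *m (V^T *m B)
      - V^T *m B *m diag_mx (\row_j h (b j)).
  by rewrite mulmxBr !mulmxA VV1 mul1mx.
rewrite -[leLHS](fro2_orthogonal_mul _ VV1) eigbasis.
rewrite -[X in _ * X](fro2_orthogonal_mul _ VV1) (eigbasis id).
rewrite !fro2E mulr_sumr; apply: ler_sum => i _.
rewrite mulr_sumr; apply: ler_sum => j _.
set Y := V^T *m B.
have entry (h : R -> R) :
    (diag_mx (\row_i h (lh i)) *m Y - Y *m diag_mx (\row_j h (b j))) i j =
    (h (lh i) - h (b j)) * Y i j.
  by rewrite mul_diag_mx mul_mx_diag !mxE mulrBl [X in _ - X]mulrC.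
rewrite entry (entry id) !exprMn [leRHS]mulrA ler_wpM2r ?sqr_ge0 //=.
move: (gL (lh i) (b j)); set u := g _ - _; set v := lh i - _; move=> uv.
rewrite -exprMn -real_normK ?num_real // -[leRHS]real_normK ?num_real //.
rewrite lerXn2r ?nnegrE ?normr_ge0 // (le_trans uv) // normrM.
by rewrite ler_wpM2r // ler_norm.
Qed.

(** The deterministic core, with constants free of n and m: the assumption on G makes F almost an
    isometry. The factor 112 is 4 (20 + 8), from the bounds on [T1] and [T2] below. *)
Lemma spectral_modify_dist_le (g : R -> R) (L : R) n m (K Kg V : 'M[R]_n)
    (lh : 'I_n -> R) (F : 'M[R]_(n, m)) (a : 'I_m -> R) :
  (forall s t, `|g s - g t| <= L * `|s - t|) -> g 0 = 0 ->
  eigendecomposition K V lh ->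
  let G := F^T *m F - 1%:M in
  let D := diag_mx (\row_j a j) in
  let Dg := diag_mx (\row_j g (a j)) in
  fro2 G <= 1 ->
  fro2 (spectral_modify g V lh - Kg) <=
  112 * L ^+ 2 * (fro2 (K - F *m D *m F^T) + fro2 D * fro2 G)
  + 4 * fro2 (Kg - F *m Dg *m F^T).
Proof.
move=> gL g0 eigK G D Dg G1.
have FF : F^T *m F = 1%:M + G by rewrite /G addrCA subrr addr0.
clearbody G.
(* Since F^T F is close to I, multiplication by F or F^T has norm at most sqrt 2. *)
have tr_bound p (C : 'M[R]_(p, m)) : fro2 (C *m F^T) <= 2 * fro2 C.
  have -> : fro2 (C *m F^T) = fro2 C + mdot (C *m G) C.
    rewrite /fro2 mdot_mulmxl trmxK -mulmxA FF mulmxDr mulmx1 mdotC.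
    by rewrite mdotDl.
  have := mdot_le (C *m G) C ltr01; rewrite invr1 !mul1r => h1.
  have h2 : fro2 (C *m G) <= fro2 C.
    apply: le_trans (fro2M_le _ _) _.
    by rewrite -[leRHS]mulr1 ler_wpM2l ?fro2_ge0.
  lra.
have bound p (C : 'M[R]_(p, n)) : fro2 (C *m F) <= 2 * fro2 C.
  (* Duality: ||C F||^2 = <C, C F F^T>, and Young with weight 2 together with [tr_bound] lets half
     of the left side be absorbed. *)
  have h0 : fro2 (C *m F) = mdot C (C *m F *m F^T).
    by rewrite {1}/fro2 mdot_mulmxl.
  have c2 : (0 : R) < 2 by [].
  have := mdot_le C (C *m F *m F^T) c2; rewrite -h0.
  have := tr_bound _ (C *m F); lra.
set E := K - _; set H := Kg - _; set gK := spectral_modify g V lh.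
(* Both terms fit the Lipschitz lemma: [T1] with B = I - F F^T and zero diagonal, [T2] with B = F
   and the diagonal of [D]. *)
pose T1 := gK *m (1%:M - F *m F^T).
pose T2 := (gK *m F - F *m Dg) *m F^T.
have -> : gK - Kg = T1 + (T2 - H).
  rewrite /T1 /T2 /H mulmxBr mulmx1 mulmxBl !mulmxA opprB.
  by rewrite !addrA !subrK.
pose e := fro2 E + fro2 D * fro2 G.
have q_le : fro2 (F *m (D *m G)) <= 2 * (fro2 D * fro2 G).
  rewrite -fro2_tr trmx_mul (le_trans (tr_bound _ _)) //.
  by rewrite fro2_tr ler_wpM2l ?fro2M_le.
have FDF : F *m D *m F^T *m F = F *m D + F *m (D *m G).
  by rewrite -mulmxA FF mulmxDr mulmx1 !mulmxA.
have q0 : 0 <= fro2 D * fro2 G by rewrite mulr_ge0 ?fro2_ge0.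
have KE : K = E + F *m D *m F^T by rewrite /E subrK.
have T1_le : fro2 T1 <= L ^+ 2 * (20 * e).
  (* With b = 0 and g 0 = 0 the right multipliers vanish, leaving ||g(K) B|| <= L ||K B||. *)
  have := spectral_modify_lipschitz (fun=> 0) (1%:M - F *m F^T) gL eigK.
  rewrite (_ : \row_j g _ = 0); last by apply/rowP => j; rewrite !mxE.
  rewrite (_ : \row_j 0 = 0); last by apply/rowP => j; rewrite !mxE.
  rewrite linear0 mulmx0 !subr0 => /le_trans; apply.
  rewrite ler_wpM2l ?sqr_ge0 //.
  have -> : K *m (1%:M - F *m F^T) =
      E + (- (E *m F *m F^T) - F *m (D *m G) *m F^T).
    rewrite {1}KE mulmxDl !mulmxBr !mulmx1 -addrA; congr (E + _).
    rewrite !mulmxA; congr (_ + _).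
    rewrite FDF mulmxDl opprD addrA subrr sub0r.
    by rewrite !mulmxA.
  have := fro2D_le E (- (E *m F *m F^T) - F *m (D *m G) *m F^T).
  have := fro2D_le (- (E *m F *m F^T)) (- (F *m (D *m G) *m F^T)).
  rewrite !fro2N.
  have := tr_bound _ (E *m F); have := bound _ E.
  have := tr_bound _ (F *m (D *m G)); have := fro2_ge0 E.
  rewrite /e; lra.
have T2_le : fro2 T2 <= L ^+ 2 * (8 * e).
  rewrite (le_trans (tr_bound _ _)) //.
  have := spectral_modify_lipschitz a F gL eigK => lip.
  rewrite (_ : _ * (8 * e) = 2 * (L ^+ 2 * (4 * e))); last by ring.
  rewrite ler_wpM2l // (le_trans lip) // ler_wpM2l ?sqr_ge0 //.
  have -> : K *m F - F *m diag_mx (\row_j a j) = E *m F + F *m (D *m G).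
    rewrite {1}KE mulmxDl FDF -/D -addrA; congr (_ + _).
    by rewrite addrC addKr.
  have := fro2D_le (E *m F) (F *m (D *m G)); have := bound _ E.
  rewrite /e; lra.
have := fro2D_le T1 (T2 - H); have := fro2D_le T2 (- H); rewrite fro2N.
have := fro2_ge0 T1; have := fro2_ge0 H.
rewrite -/e; lra.
Qed.

End FrobeniusInnerProduct.

(** * Strong law of large numbers for bounded functions of the samples *)

Section StrongLaw.
Set Implicit Arguments.
Unset Strict Implicit.

Lemma bounded_integrable (R : realType) d (T : measurableType d)
    (mu : probability T R) (f : T -> R) (B : R) :
  measurable_fun [set: T] f -> (forall x, `|f x| <= B) ->
  mu.-integrable [set: T] (EFin \o f).
Proof.
move=> mf fB; apply: measurable_bounded_integrable => //.
  by rewrite (le_lt_trans (probability_le1 mu measurableT)) ?ltry.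
by exists B; split; rewrite ?num_real // => x Bx y _; exact/(le_trans (fB y))/ltW.
Qed.

(** Each term is at most 2/(i+1) - 2/(i+2), so the bound telescopes. *)
Lemma sum_inv_sqr_le (R : realType) (n : nat) :
  \sum_(0 <= i < n) (i.+1%:R ^+ 2)^-1 <= 2 - 2 / n.+1%:R :> R.
Proof.
elim: n => [|n IHn]; first by rewrite big_geq // divr1 subrr.
rewrite big_nat_recr //=; apply: le_trans (lerD IHn (lexx _)) _.
have x0 : (0 : R) < n.+1%:R by rewrite ltr0n.
have -> : (n.+2%:R : R) = n.+1%:R + 1 by rewrite -natr1.
have x1 : (1 : R) <= n.+1%:R by rewrite ler1n.
move: x0 x1; set x := n.+1%:R => x0 x1.
rewrite -subr_ge0 (_ : _ - _ = (x - 1) / (x ^+ 2 * (x + 1))).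
  by rewrite divr_ge0 ?mulr_ge0 ?sqr_ge0 //; lra.
by field; apply/andP; split; apply/eqP; lra.
Qed.

(** The squares of m+1 and m+2 differ by 2(m+1) + 1, so n lies within 2(m+1) of the largest square
    below it. *)
Lemma square_bracket (n : nat) : (0 < n)%N ->
  exists m, (m.+1 ^ 2 <= n)%N && (n <= m.+1 ^ 2 + m.+1.*2)%N.
Proof.
elim: n => [//|[|n] IHn] _; first by exists 0.
have [m /andP[h1 h2]] := IHn isT.
have [h3|h3] := leqP n.+2 (m.+1 ^ 2 + m.+1.*2).
  by exists m; rewrite h3 andbT; lia.
by exists m.+1; rewrite -muln2 !expnS expn0 in h1 h2 h3 *; lia.
Qed.

(** From (m+1)^2 up to n the sequence moves by at most 2B(m+1), negligible against (m+1)^2 <= n. *)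
Lemma cesaro_from_squares (R : realType) (s : nat -> R) (B : R) :
  (forall n, `|s n.+1 - s n| <= B) ->
  (fun m => s (m.+1 ^ 2)%N / (m.+1 ^ 2)%:R) @ \oo --> 0 ->
  (fun n => n%:R^-1 * s n) @ \oo --> 0.
Proof.
move=> sB zcvg.
have B0 : 0 <= B by exact: le_trans (normr_ge0 _) (sB 0).
have sD n j : `|s (n + j)%N - s n| <= B * j%:R.
  elim: j => [|j IHj]; first by rewrite addn0 subrr normr0 mulr0.
  rewrite addnS -(subrKA (s (n + j)%N)) (le_trans (ler_normD _ _)) //.
  by rewrite -natr1 mulrDr mulr1 addrC lerD.
have bcvg : (fun m => 2 * B * (m.+1%:R^-1)) @ \oo --> (0 : R).
  by rewrite -(mulr0 (2 * B)); apply: cvgM; [exact: cvg_cst|exact: cvg_harmonic].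
apply/cvgr0Pnorm_le => e e0.
have e20 : 0 < e / 2 by rewrite divr_gt0.
have [N1 _ h1] := (cvgr0Pnorm_le _).1 zcvg _ e20.
have [N2 _ h2] := (cvgr0Pnorm_le _).1 bcvg _ e20.
pose N := (maxn N1 N2).
(* Beyond this threshold the bracketing square has index m >= N. *)
exists ((N.+2 ^ 2)%N) => // n /= Nn.
have n0 : (0 < n)%N by apply: leq_trans Nn; rewrite expn_gt0.
have [m /andP[mn nm]] := square_bracket n0.
have Nm : (N <= m)%N.
  rewrite leqNgt; apply/negP => mN; move: Nn nm mN.
  by rewrite -muln2 !expnS expn0; nia.
have {h1} := h1 m (leq_trans (leq_maxl _ _) Nm).
have {h2} := h2 m (leq_trans (leq_maxr _ _) Nm).
have M0 : (0 : R) < m.+1%:R by rewrite ltr0n.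
have M20 : (0 : R) < (m.+1 ^ 2)%:R by rewrite ltr0n expn_gt0.
rewrite ger0_norm; last by rewrite mulr_ge0 ?mulr_ge0 ?invr_ge0 // ltW.
rewrite normrM [`|_^-1|]ger0_norm ?invr_ge0 ?(ltW M20) // => hb hz.
rewrite normrM [`|_^-1|]ger0_norm ?invr_ge0 ?ler0n // mulrC.
apply: (@le_trans _ _ (`|s n| / (m.+1 ^ 2)%:R)).
  by rewrite ler_wpM2l // lef_pV2 ?posrE ?ltr0n // ler_nat.
have := sD (m.+1 ^ 2)%N (n - m.+1 ^ 2)%N; rewrite subnKC // => hs.
have {}hs : `|s n| <= `|s (m.+1 ^ 2)%N| + B * (2 * m.+1%:R).
  rewrite -(subrK (s (m.+1 ^ 2)%N) (s n)) addrC (le_trans (ler_normD _ _)) //.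
  rewrite lerD2l (le_trans hs) // ler_wpM2l // -natrM ler_nat.
  by rewrite leq_subLR mul2n.
apply: (@le_trans _ _ ((`|s (m.+1 ^ 2)%N| + B * (2 * m.+1%:R)) / (m.+1 ^ 2)%:R)).
  by rewrite ler_wpM2r // invr_ge0 ltW.
rewrite mulrDl (_ : B * _ / _ = 2 * B / m.+1%:R).
  by rewrite [leRHS]splitr lerD.
by rewrite natrX; field; rewrite gt_eqF.
Qed.

Context {R : realType} {d dT : measure_display} {Omega : measurableType d}
  (P : probability Omega R) {T : measurableType dT} (mu : probability T R)
  (Xs : nat -> Omega -> T).
Hypothesis Xs_meas : forall i, measurable_fun [set: Omega] (Xs i).
Hypothesis Xs_law : forall i (A : set T), measurable A -> P (Xs i @^-1` A) = mu A.
Hypothesis Xs_indep : mutually_independent P Xs.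

(** Independence makes the joint law of two distinct samples agree with the product measure on
    rectangles, hence everywhere; Fubini then gives the iterated integral. *)
Lemma integral_pair_law (F : T * T -> R) (C : R) (a b : nat) : a != b ->
  measurable_fun [set: T * T] F -> (forall p, `|F p| <= C) ->
  (\int[P]_w (F (Xs a w, Xs b w))%:E =
   \int[mu]_x \int[mu]_y (F (x, y))%:E)%E.
Proof.
move=> ab mF FC.
have mX : measurable_fun [set: Omega] (fun w => (Xs a w, Xs b w)).
  exact: measurable_fun_pair.
have mEF : measurable_fun [set: T * T] (fun z => (F z)%:E) by exact/measurable_EFinP.
rewrite (@integral12_prod_meas1 _ _ _ _ _ mu mu (fun z => (F z)%:E)) //; last first.
  exact: (@bounded_integrable _ _ _ (mu \x mu)%E _ C).
transitivity (\int[pushforward P (fun w => (Xs a w, Xs b w))]_z (F z)%:E)%E.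
  rewrite integral_pushforward //.
  apply: (@bounded_integrable _ _ _ P _ C) => //.
  exact: measurableT_comp mF mX.
apply: eq_measure_integral => A mA _; apply/esym/product_measure_unique => //.
move=> B D mB mD.
pose A' j := if j == a then B else D.
have := @Xs_indep [:: a; b] A'; rewrite /= inE ab => /(_ isT).
have mA' j : j \in [:: a; b] -> measurable (A' j).
  by move=> _; rewrite /A'; case: ifP.
move=> /(_ mA'); rewrite big_cons big_seq1 !Xs_law; last 2 first.
- by apply: mA'; rewrite !inE eqxx orbT.
- by apply: mA'; rewrite !inE eqxx.
rewrite {2 3}/A' eqxx eq_sym (negbTE ab) => <-; rewrite /pushforward.
congr (P _); apply/seteqP; split=> w /=.
  move=> [Bw Dw] j /=; rewrite !inE => /orP[|] /eqP ->.
    by rewrite /A' eqxx.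
  by rewrite /A' eq_sym (negbTE ab).
move=> h; split.
  by have := h a; rewrite /= /A' eqxx inE eqxx; apply.
by have := h b; rewrite /= /A' eq_sym (negbTE ab) !inE eqxx orbT; apply.
Qed.

(** The n diagonal terms are bounded by [C], and each of the n(n-1) others has mean [c]. It serves
    both for the variance in the strong law and for the sign of the eigenvalues. *)
Lemma expectation_double_sum_le (F : T * T -> R) (C c : R) (n : nat) :
  measurable_fun [set: T * T] F -> (forall p, `|F p| <= C) ->
  (\int[mu]_x \int[mu]_y (F (x, y))%:E = c%:E)%E ->
  (\int[P]_w (\sum_(a < n) \sum_(b < n) F (Xs a w, Xs b w))%:E <=
   (n%:R * C + n%:R * n.-1%:R * c)%:E)%E.
Proof.
move=> mF FC Fc.
have intF a b : P.-integrable [set: Omega] (fun w => (F (Xs a w, Xs b w))%:E).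
  apply: (@bounded_integrable _ _ _ P _ C) => //.
  apply: measurableT_comp mF _; exact: measurable_fun_pair.
under eq_integral do rewrite -sumEFin.
rewrite integral_sum //; last first.
  move=> a; under eq_fun do rewrite -sumEFin; exact: integrable_sum.
have -> : (n%:R * C + n%:R * n.-1%:R * c)%:E =
    (\sum_(a < n) (C + n.-1%:R * c)%:E)%E.
  rewrite sumEFin sumr_const card_ord -mulr_natl.
  by congr EFin; ring.
apply: lee_sum => a _.
under eq_integral do rewrite -sumEFin.
rewrite integral_sum // (bigD1 a) //= EFinD; apply: leeD.
  apply: (@le_trans _ _ (\int[P]_(w in [set: Omega]) (cst C%:E w))%E).
    apply: le_integral => //; first exact: (@bounded_integrable _ _ _ P (cst C) `|C|).
    by move=> w _; rewrite lee_fin (le_trans (ler_norm _)).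
  by rewrite integral_cst // [X in (_ * X)%E](probability_setT P) mule1.
have -> : (n.-1%:R * c)%:E = (\sum_(b < n | b != a) c%:E)%E.
  rewrite sumEFin (eq_bigl (mem (predC1 a))) // sumr_const cardC1 card_ord.
  by rewrite mulr_natl.
apply: lee_sum => b ba.
by rewrite (integral_pair_law _ mF FC) ?Fc // eq_sym.
Qed.

(* The second moments of the averages along n = m^2 are O(1 / m^2), hence summable;
   boundedness of [f] then fills the gaps between consecutive squares. *)
Lemma strong_law (f : T -> R) (B : R) :
  measurable_fun [set: T] f -> (forall x, `|f x| <= B) ->
  (\int[mu]_x (f x)%:E = 0)%E ->
  {ae P, forall w, (fun n => n%:R^-1 * \sum_(i < n) f (Xs i w)) @ \oo --> 0}.
Proof.
move=> mf fB f0.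
have B0 : 0 <= B by exact: le_trans (normr_ge0 _) (fB point).
pose S n w := \sum_(i < n) f (Xs i w).
have mS n : measurable_fun [set: Omega] (S n).
  by apply: measurable_sum => i; exact: measurableT_comp.
have S2 n : (\int[P]_w ((S n w) ^+ 2)%:E <= (n%:R * B ^+ 2)%:E)%E.
  pose F (p : T * T) := f p.1 * f p.2.
  have mF : measurable_fun [set: T * T] F.
    by apply: measurable_funM; exact: measurableT_comp.
  have FC p : `|F p| <= B ^+ 2.
    by rewrite normrM expr2 ler_pM.
  have F0 : (\int[mu]_x \int[mu]_y (F (x, y))%:E = 0%:E)%E.
    under eq_integral => x _.
      under eq_integral do rewrite /F /= EFinM.
      rewrite integralZl ?f0 ?mule0 //; last exact: (@bounded_integrable _ _ _ mu _ B).
      over.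
    by rewrite integral0.
  have := expectation_double_sum_le n mF FC F0; rewrite mulr0 addr0.
  apply: le_trans; rewrite le_eqVlt; apply/orP; left; apply/eqP.
  apply: eq_integral => w _; congr EFin; rewrite expr2 /S mulr_suml.
  by apply: eq_bigr => a _; rewrite mulr_sumr.
pose Z m w := S (m.+1 ^ 2)%N w / (m.+1 ^ 2)%:R.
have mZ m : measurable_fun [set: Omega] (fun w => ((Z m w) ^+ 2)%:E).
  apply/measurable_EFinP; apply: measurable_funX; exact: measurable_funM.
have Z2 m : (\int[P]_w ((Z m w) ^+ 2)%:E <= (B ^+ 2 * (m.+1%:R ^+ 2)^-1)%:E)%E.
  have m0 : (0 : R) < (m.+1 ^ 2)%:R by rewrite ltr0n expn_gt0.
  under eq_integral do rewrite /Z exprMn mulrC EFinM.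
  rewrite ge0_integralZl_EFin //; first last.
  - by apply/measurable_EFinP; exact: measurable_funX.
  - by move=> w _; rewrite lee_fin sqr_ge0.
  apply: le_trans (lee_wpmul2l _ (S2 _)) _; first by rewrite lee_fin sqr_ge0.
  rewrite -EFinM lee_fin le_eqVlt; apply/orP; left; apply/eqP.
  by rewrite natrX; field; rewrite gt_eqF // ltr0n.
(* By Tonelli the expected sum of the squares Z_m^2 is at most 2 B^2; the sum is thus almost surely
   finite and its terms tend to 0. *)
have sumZ : (\int[P]_w (\sum_(m <oo) ((Z m w) ^+ 2)%:E) < +oo)%E.
  rewrite integral_nneseries //; last by move=> m w _; rewrite lee_fin sqr_ge0.
  apply: (@le_lt_trans _ _ (B ^+ 2 * 2)%:E); last by rewrite ltry.
  apply: lime_le.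
    by apply: is_cvg_nneseries => m _ _; apply: integral_ge0 => w _;
      rewrite lee_fin sqr_ge0.
  apply: nearW => n; apply: le_trans (lee_sum _ (fun m _ => Z2 m)) _.
  rewrite sumEFin lee_fin -mulr_sumr ler_wpM2l ?sqr_ge0 //.
  apply: le_trans (sum_inv_sqr_le _ _) _.
  by rewrite gerDl oppr_le0 divr_ge0.
have intZ : P.-integrable [set: Omega] (fun w => \sum_(m <oo) ((Z m w) ^+ 2)%:E)%E.
  apply/integrableP; split.
    apply: ge0_emeasurable_sum => //.
    by move=> m w _ _; rewrite lee_fin sqr_ge0.
  apply: le_lt_trans sumZ; rewrite le_eqVlt; apply/orP; left; apply/eqP.
  apply: eq_integral => w _; rewrite gee0_abs // nneseries_ge0 // => m _ _.
  by rewrite lee_fin sqr_ge0.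
have := integrable_ae measurableT intZ.
apply: filterS => w /(_ I) finw.
have Zcvg : (fun m => (Z m w) ^+ 2) @ \oo --> 0.
  apply: cvg_series_cvg_0; apply: nnseries_is_cvg => [m|]; first exact: sqr_ge0.
  move: finw; rewrite ge0_fin_numE // nneseries_ge0 // => m _ _.
  by rewrite lee_fin sqr_ge0.
apply: (@cesaro_from_squares _ (S ^~ w) B) => [n|].
  by rewrite /= /S big_ord_recr /= addrAC subrr add0r.
apply/cvgr0Pnorm_le => e e0.
have e20 : 0 < e ^+ 2 by rewrite exprn_gt0.
have [N _ hN] := (cvgr0Pnorm_le _).1 Zcvg _ e20.
exists N => // m /hN /=; rewrite -/(Z m w).
by rewrite normrX ler_pXn2r ?nnegrE ?(ltW e0).
Qed.

End StrongLaw.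

(** * Truncation of the Mercer expansion *)

Section BoundedExpansion.
Set Implicit Arguments.
Unset Strict Implicit.
Context {R : realType}.

(** For N >= m the partial sums differ by at most B times the sum of [a] over [m, N); then N tends
    to infinity. *)
Lemma series_tail_le (a p : nat -> R) (c B : R) (m : nat) :
  (forall i, 0 <= a i) -> cvgn (series a) ->
  (forall i, `|p i| <= B) ->
  (fun N => \sum_(0 <= i < N) a i * p i) @ \oo --> c ->
  `|c - \sum_(0 <= i < m) a i * p i| <= B * (limn (series a) - series a m).
Proof.
move=> a0 acvg pB ccvg.
have nda : nondecreasing_seq (series a).
  by apply: nondecreasing_series => i _ _; exact: a0.
have dcvg : (fun N => `|\sum_(0 <= i < N) a i * p i - \sum_(0 <= i < m) a i * p i|)
    @ \oo --> `|c - \sum_(0 <= i < m) a i * p i|.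
  by apply: cvg_norm; apply: cvgB => //; exact: cvg_cst.
rewrite -(cvg_lim (@Rhausdorff R) dcvg).
apply: limr_le; first exact: cvgP dcvg.
exists m => // N /= mN.
have B0 : 0 <= B by exact: le_trans (normr_ge0 _) (pB 0).
apply: (@le_trans _ _ (B * (series a N - series a m))); last first.
  by rewrite ler_wpM2l // lerD2r nondecreasing_cvgn_le.
rewrite /series /= (big_cat_nat (n := m)) //= [X in _ * (X - _)](big_cat_nat (n := m)) //=.
rewrite addrAC subrr add0r addrAC subrr add0r mulr_sumr.
apply: le_trans (ler_norm_sum _ _ _) _; apply: ler_sum => i _.
by rewrite normrM ger0_norm // mulrC ler_wpM2r.
Qed.

Lemma series_tail_cvg0 (a : nat -> R) : cvgn (series a) ->
  (fun m => limn (series a) - series a m) @ \oo --> 0.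
Proof.
by move=> acvg; rewrite -(subrr (limn (series a))); apply: cvgB => //; exact: cvg_cst.
Qed.

Context {X : Type} (Phi : nat -> X -> R) (M : R).
Hypothesis Phi_le : forall i x, `|Phi i x| <= M.

(** The matrix F of the overview. The factor 1/sqrt n makes F^T F the empirical Gram matrix of the
    eigenfunctions and gives F D F^T the factor 1/n of a kernel matrix. *)
Definition feature_matrix (n m : nat) (x : 'I_n -> X) : 'M[R]_(n, m) :=
  \matrix_(i, j) (Num.sqrt n%:R^-1 * Phi j (x i)).

Lemma truncated_kernel_matrixE (n m : nat) (x : 'I_n -> X) (a : nat -> R) i j :
  (feature_matrix m x *m diag_mx (\row_(l < m) a l) *m (feature_matrix m x)^T) i j =
  n%:R^-1 * \sum_(0 <= l < m) a l * (Phi l (x i) * Phi l (x j)).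
Proof.
rewrite mxE big_mkord mulr_sumr; apply: eq_bigr => l _.
rewrite mul_mx_diag !mxE -[X in X * (a l * _)](@sqr_sqrtr _ n%:R^-1) ?invr_ge0 ?ler0n //.
by ring.
Qed.

Lemma gram_matrixE (n m : nat) (x : 'I_n -> X) (i j : 'I_m) :
  ((feature_matrix m x)^T *m feature_matrix m x) i j =
  n%:R^-1 * \sum_(l < n) Phi i (x l) * Phi j (x l).
Proof.
rewrite mxE mulr_sumr; apply: eq_bigr => l _.
rewrite !mxE -[X in X * (Phi i _ * _)](@sqr_sqrtr _ n%:R^-1) ?invr_ge0 ?ler0n //.
by ring.
Qed.

(** Each of the n^2 entries is at most t/n in absolute value, so n cancels in the sum of squares and
    the bound is uniform in n. *)
Lemma truncation_error_le (f : X -> X -> R) (a : nat -> R) (n m : nat)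
    (x : 'I_n -> X) :
  (forall i, 0 <= a i) -> cvgn (series a) ->
  (forall y z, (fun N => \sum_(0 <= i < N) a i * Phi i y * Phi i z) @ \oo --> f y z) ->
  fro2 (kernel_matrix f x
        - feature_matrix m x *m diag_mx (\row_(l < m) a l) *m (feature_matrix m x)^T)
  <= (M ^+ 2 * (limn (series a) - series a m)) ^+ 2.
Proof.
move=> a0 acvg fcvg; set t := M ^+ 2 * _.
case: n x => [|n] x.
  by rewrite fro2E big_ord0 sqr_ge0.
have n0 : (0 : R) < n.+1%:R by rewrite ltr0n.
have t_le y z :
    `|f y z - \sum_(0 <= l < m) a l * (Phi l y * Phi l z)| <= t.
  apply: series_tail_le => // [i|].
    by rewrite normrM expr2 ler_pM.
  by have := fcvg y z; under eq_fun do under eq_bigr do rewrite -mulrA.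
clearbody t; rewrite fro2E.
apply: (@le_trans _ _ (\sum_(i < n.+1) \sum_(j < n.+1) (n.+1%:R^-1 * t) ^+ 2)).
  apply: ler_sum => i _; apply: ler_sum => j _.
  rewrite mxE [X in (_ + X) ^+ 2]mxE truncated_kernel_matrixE mxE -mulrBr !exprMn.
  rewrite ler_wpM2l ?sqr_ge0 // -[leLHS]real_normK ?num_real //.
  have := t_le (x i) (x j); set u := `|_| => ut.
  have u0 : 0 <= u by exact: normr_ge0.
  by rewrite lerXn2r ?nnegrE // (le_trans u0).
rewrite !sumr_const !card_ord le_eqVlt; apply/orP; left; apply/eqP.
rewrite -mulrnA -[LHS]mulr_natl natrM exprMn mulrA exprVn.
by rewrite -expr2 mulfV ?mul1r // expf_neq0 // gt_eqF.
Qed.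

End BoundedExpansion.

(** * Convergence along a fixed sample sequence *)

Section DeterministicLimit.
Set Implicit Arguments.
Unset Strict Implicit.
Context {R : realType} {X : Type} (Phi : nat -> X -> R) (M : R).
Hypothesis Phi_le : forall i x, `|Phi i x| <= M.

Lemma gram_defect_cvg0 (x : nat -> X) (m : nat) :
  (forall i j, (fun n => n%:R^-1 *
      \sum_(l < n) (Phi i (x l) * Phi j (x l) - (i == j)%:R)) @ \oo --> 0) ->
  (fun n => fro2 ((feature_matrix Phi m (fun l : 'I_n => x l))^T
                  *m feature_matrix Phi m (fun l : 'I_n => x l) - 1%:M)) @ \oo --> 0.
Proof.
move=> gram.
pose u i j n : R := n%:R^-1 * \sum_(l < n) (Phi i (x l) * Phi j (x l) - (i == j)%:R).
have sumcvg (I : finType) (v : I -> nat -> R) :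
    (forall i, v i @ \oo --> 0) -> (fun n => \sum_i v i n) @ \oo --> 0.
  move=> vcvg; rewrite (_ : (fun n => _) = \sum_i v i); last first.
    by apply/funext => n; rewrite fct_sumE.
  apply: (big_ind (fun h : nat -> R => h @ \oo --> (0 : R))) => //.
    exact: cvg_cst.
  by move=> h h' hcvg hcvg'; rewrite -(addr0 0); exact: cvgD.
have : (fun n => \sum_(i < m) \sum_(j < m) (u i j n) ^+ 2) @ \oo --> 0.
  apply: (sumcvg 'I_m (fun (i : 'I_m) n => \sum_(j < m) u i j n ^+ 2)) => i.
  apply: (sumcvg 'I_m (fun (j : 'I_m) n => u i j n ^+ 2)) => j.
  by have := cvgM (gram i j) (gram i j); rewrite mulr0; exact.
apply: cvg_trans; apply: near_eq_cvg.
(* For n = 0 the inverse is 0 and the centring term would be lost, so the entries are compared only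
   from n = 1 on. *)
exists 1%N => // n /= n0; rewrite fro2E.
apply: eq_bigr => i _; apply: eq_bigr => j _; congr (_ ^+ 2).
rewrite mxE gram_matrixE /u sumrB sumr_const card_ord !mxE mulrBr; congr (_ - _).
by rewrite -[X in _ * X]mulr_natl mulrA mulVf ?mul1r // pnatr_eq0 -lt0n.
Qed.

(** Order of choices: first m, making the truncation tails small uniformly in n, then n, making the
    Gram defect small for this m. *)
Lemma spectral_modify_cvg (k kg : X -> X -> R) (lam : nat -> R) (g : R -> R)
    (L : R) (x : nat -> X) (V : forall n, 'M[R]_n) (lh : forall n, 'I_n -> R) :
  (forall s t, `|g s - g t| <= L * `|s - t|) -> (forall t, 0 <= g t) ->
  (forall i, 0 <= lam i) ->
  cvgn (series lam) -> cvgn (series (g \o lam)) ->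
  (forall y z, (fun N => \sum_(0 <= i < N) lam i * Phi i y * Phi i z) @ \oo --> k y z) ->
  (forall y z, (fun N => \sum_(0 <= i < N) g (lam i) * Phi i y * Phi i z) @ \oo --> kg y z) ->
  (forall i j, (fun n => n%:R^-1 *
      \sum_(l < n) (Phi i (x l) * Phi j (x l) - (i == j)%:R)) @ \oo --> 0) ->
  (forall n, eigendecomposition (kernel_matrix k (fun l : 'I_n => x l)) (V n) (lh n)) ->
  (fun n => frobenius (spectral_modify g (V n) (lh n)
                       - kernel_matrix kg (fun l : 'I_n => x l))) @ \oo --> 0.
Proof.
move=> gL g_ge0 lam0 lamcvg glamcvg kcvg kgcvg gram eigV.
(* Both lam_i and g(lam_i) tend to 0 as terms of convergent series, while |g 0| <= g(lam_i) + L
   lam_i. *)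
have g0 : g 0 = 0.
  apply/eqP; rewrite -normr_le0.
  have lam_cvg0 := cvg_series_cvg_0 lamcvg.
  have Llam_cvg0 : (fun i => L * lam i) @ \oo --> L * 0.
    exact: cvgM (cvg_cst _) lam_cvg0.
  have ucvg : (fun i => g (lam i) + L * lam i) @ \oo --> 0.
    rewrite -(addr0 0) -{2}(mulr0 L).
    exact: cvgD (cvg_series_cvg_0 glamcvg) Llam_cvg0.
  apply: (cvgr_to_ge ucvg); apply: nearW => i /=.
  rewrite -[g 0](addrNK (g (lam i))) [_ - _ + _]addrC.
  rewrite (le_trans (ler_normD _ _)) //.
  by rewrite ger0_norm // lerD2l (le_trans (gL _ _)) // sub0r normrN ger0_norm.
pose tl (a : nat -> R) m := (M ^+ 2 * (limn (series a) - series a m)) ^+ 2.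
have tlcvg a : cvgn (series a) -> tl a @ \oo --> 0.
  move=> acvg.
  have tcvg : (fun m => M ^+ 2 * (limn (series a) - series a m)) @ \oo --> 0.
    rewrite -(mulr0 (M ^+ 2)).
    exact: cvgM (cvg_cst _) (series_tail_cvg0 acvg).
  by have := cvgM tcvg tcvg; rewrite mulr0; exact.
have ccvg : (fun m => 112 * L ^+ 2 * tl lam m + 4 * tl (g \o lam) m) @ \oo --> 0.
  have h1 : (fun m => 112 * L ^+ 2 * tl lam m) @ \oo --> 112 * L ^+ 2 * 0.
    exact: cvgM (cvg_cst _) (tlcvg _ lamcvg).
  have h2 : (fun m => 4 * tl (g \o lam) m) @ \oo --> (4 * 0 : R).
    exact: cvgM (cvg_cst _) (tlcvg _ glamcvg).
  have := cvgD h1 h2.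
  by rewrite !mulr0 addr0; exact.
apply/cvgr0Pnorm_le => e e0.
(* The estimate concerns the squared norm: half of e^2 goes to the tails, half to the Gram
   defect. *)
have e20 : 0 < e ^+ 2 / 2 by rewrite divr_gt0 // exprn_gt0.
have [m _ /(_ m (leqnn m)) /= hm] := (cvgr0Pnorm_le _).1 ccvg _ e20.
have {}hm := le_trans (ler_norm _) hm.
have Gcvg := @gram_defect_cvg0 x m gram.
pose D : 'M[R]_m := diag_mx (\row_j lam j).
have DGcvg : (fun n => 112 * L ^+ 2 * fro2 D *
    fro2 ((feature_matrix Phi m (fun l : 'I_n => x l))^T
          *m feature_matrix Phi m (fun l : 'I_n => x l) - 1%:M)) @ \oo --> 0.
  rewrite -(mulr0 (112 * L ^+ 2 * fro2 D)).
  exact: cvgM (cvg_cst _) Gcvg.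
have [N1 _ h1] := (cvgr0Pnorm_le _).1 Gcvg _ ltr01.
have [N2 _ h2] := (cvgr0Pnorm_le _).1 DGcvg _ e20.
exists (maxn N1 N2) => // n /=; rewrite geq_max => /andP[N1n N2n].
have {}h1 := le_trans (ler_norm _) (h1 n N1n).
have {}h2 := le_trans (ler_norm _) (h2 n N2n).
rewrite ger0_norm ?sqrtr_ge0 //.
rewrite -(@ler_pXn2r _ 2) ?nnegrE ?sqrtr_ge0 ?(ltW e0) // /frobenius -fro2E.
rewrite sqr_sqrtr ?fro2_ge0 //.
have bound := @spectral_modify_dist_le R g L n m _
  (kernel_matrix kg (fun l : 'I_n => x l)) _ _ _ lam gL g0 (eigV n) h1.
apply: le_trans bound _.
have Ek := truncation_error_le Phi_le m (fun l : 'I_n => x l) lam0 lamcvg kcvg.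
have Ekg := truncation_error_le Phi_le m (fun l : 'I_n => x l)
  (fun i => g_ge0 (lam i)) glamcvg kgcvg.
rewrite [leRHS]splitr; apply: le_trans (lerD hm h2).
rewrite mulrDr addrAC mulrA lerD2r lerD //.
  by rewrite ler_wpM2l // mulr_ge0 ?sqr_ge0.
by rewrite ler_wpM2l.
Qed.

End DeterministicLimit.

(** * Sign and summability of the Mercer coefficients *)

Section MercerCoefficients.
Set Implicit Arguments.
Unset Strict Implicit.
Context {R : realType} {X : pointedMetricType R} (mu : probability (borelT X) R).
Context (Phi : nat -> X -> R) (M : R).
Hypothesis Phi_meas : forall i, measurable_fun [set: borelT X] (Phi i : borelT X -> R).
Hypothesis Phi_orth : forall i j,
  mu.-integrable [set: borelT X] (fun x : borelT X => (Phi i x * Phi j x)%:E) /\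
  (\int[mu]_x (Phi i x * Phi j x)%:E)%E = (if i == j then 1 else 0)%:E.
Hypothesis Phi_le : forall i x, `|Phi i x| <= M.

Lemma mercer_kernel_bounded (k : X -> X -> R) :
  compact [set: X] -> mercer_kernel k -> exists C, forall x z, `|k x z| <= C.
Proof.
move=> Xcompact [kcont _ _].
have XXcompact : compact [set: X * X].
  by rewrite -setXTT; exact: compact_setX.
have : bounded_set ((fun p : X * X => k p.1 p.2) @` [set: X * X]).
  apply: compact_bounded; apply: continuous_compact XXcompact.
  exact/continuous_subspaceT.
case=> C [_ hC]; exists (C + 1) => x z.
by apply: (hC (C + 1)); rewrite ?ltrDl //; exists (x, z).
Qed.

(** On the diagonal the partial sums of a_i Phi_i(x)^2 increase to f(x, x) <= C. Integrating against
    the probability [mu], with Phi_i of norm one, bounds the partial sums of [a] by [C]. *)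
Lemma mercer_coefficients_summable (f : X -> X -> R) (a : nat -> R) (C : R) :
  (forall i, 0 <= a i) -> (forall x, `|f x x| <= C) ->
  (forall x z, (fun N => \sum_(0 <= i < N) a i * Phi i x * Phi i z) @ \oo --> f x z) ->
  cvgn (series a).
Proof.
move=> a0 fC fcvg.
apply: nondecreasing_is_cvgn.
  by apply: nondecreasing_series => i _ _; exact: a0.
exists C => _ [N _ <-].
have nd x : nondecreasing_seq (series (fun i => a i * Phi i x * Phi i x)).
  apply: nondecreasing_series => i _ _.
  by rewrite -mulrA -expr2 mulr_ge0 ?sqr_ge0.
have sum_le (x : borelT X) : \sum_(0 <= i < N) a i * (Phi i x * Phi i x) <= C.
  under eq_bigr do rewrite mulrA.
  have := nondecreasing_cvgn_le (nd x) (cvgP _ (fcvg x x)) N.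
  rewrite (cvg_lim (@Rhausdorff R) (fcvg x x)) => /le_trans; apply.
  exact: le_trans (ler_norm _) (fC x).
have int1 i : mu.-integrable [set: borelT X]
    (fun x : borelT X => (a i * (Phi i x * Phi i x))%:E).
  by under eq_fun do rewrite EFinM; apply: integrableZl => //; exact: (Phi_orth i i).1.
rewrite -lee_fin.
have <- : (\int[mu]_x (\sum_(0 <= i < N) a i * (Phi i x * Phi i x))%:E
           = (series a N)%:E)%E.
  under eq_integral do rewrite -sumEFin.
  rewrite integral_sum // -sumEFin; apply: eq_bigr => i _.
  under eq_integral do rewrite EFinM.
  by rewrite integralZl //; [rewrite (Phi_orth i i).2 eqxx mule1|exact: (Phi_orth i i).1].
apply: (@le_trans _ _ (\int[mu]_(x in [set: borelT X]) (cst C%:E x))%E).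
  apply: le_integral => //.
  - under eq_fun do rewrite -sumEFin; exact: integrable_sum.
  - exact: (@bounded_integrable _ _ _ mu (cst C) `|C|).
  - by move=> x _; rewrite lee_fin.
by rewrite integral_cst // [X in (_ * X)%E](probability_setT mu) mule1.
Qed.

(* Integrating the nonnegative form sum_(a, b) k(X_a, X_b) Phi_i(X_a) Phi_i(X_b) over
   [m] samples gives at most [m C + m (m - 1) lam_i], hence the sign as m grows. *)
Lemma mercer_eigenvalue_ge0 (k : X -> X -> R) (lam : nat -> R)
    (dO : measure_display) (Omega : measurableType dO) (P : probability Omega R)
    (Xs : nat -> Omega -> borelT X) :
  (forall i, measurable_fun [set: Omega] (Xs i)) ->
  (forall i (A : set (borelT X)), measurable A -> P (Xs i @^-1` A) = mu A) ->
  mutually_independent P Xs ->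
  compact [set: X] -> mercer_kernel k ->
  (forall i, {ae mu, forall x : borelT X,
      (\int[mu]_z (k x z * Phi i z)%:E)%E = (lam i * Phi i x)%:E}) ->
  (forall x z, (fun N => \sum_(0 <= i < N) lam i * Phi i x * Phi i z) @ \oo --> k x z) ->
  forall i, 0 <= lam i.
Proof.
move=> Xs_meas Xs_law Xs_indep Xcompact hk eig kcvg i.
have [C kC] := mercer_kernel_bounded Xcompact hk.
have [_ _ kpd] := hk.
pose F (p : borelT X * borelT X) := k p.1 p.2 * (Phi i p.1 * Phi i p.2).
have mPhi1 j : measurable_fun [set: borelT X * borelT X]
    (fun p : borelT X * borelT X => Phi j p.1).
  exact: measurableT_comp (Phi_meas j) measurable_fst.
have mPhi2 j : measurable_fun [set: borelT X * borelT X]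
    (fun p : borelT X * borelT X => Phi j p.2).
  exact: measurableT_comp (Phi_meas j) measurable_snd.
(* Measurability for the product sigma-algebra comes from the Mercer expansion, a pointwise limit of
   measurable sums. *)
have mk : measurable_fun [set: borelT X * borelT X]
    (fun p : borelT X * borelT X => k p.1 p.2).
  apply: (@measurable_fun_cvg _ _ _ _ (fun N (p : borelT X * borelT X) =>
    \sum_(0 <= j < N) lam j * Phi j p.1 * Phi j p.2)) => [N|p _]; last exact: kcvg.
  apply: measurable_sum => j; apply: measurable_funM => //.
  exact: measurable_funM.
have mF : measurable_fun [set: borelT X * borelT X] F.
  by apply: measurable_funM => //; exact: measurable_funM.
have FC p : `|F p| <= C * (M * M).
  by rewrite !normrM; do 2 (apply: ler_pM => //; rewrite ?mulr_ge0 //).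
have intF : (mu \x mu)%E.-integrable [set: borelT X * borelT X]
   (fun p : borelT X * borelT X => (F p)%:E).
  exact: (@bounded_integrable _ _ _ (mu \x mu)%E _ (C * (M * M))).
have inner (x : borelT X) : (\int[mu]_y (F (x, y))%:E =
    (Phi i x)%:E * \int[mu]_y (k x y * Phi i y)%:E)%E.
  rewrite -integralZl //.
    by apply: eq_integral => y _; rewrite -EFinM /F /= mulrCA.
  apply: (@bounded_integrable _ _ _ mu _ (C * M)) => [|y].
    apply: measurable_funM => //.
    exact: measurableT_comp mk (measurable_pair1 x).
  by rewrite normrM ler_pM.
(* The eigenvalue equation evaluates the inner integral almost everywhere; normalization of Phi_i
   does the rest. *)
have Flam : (\int[mu]_x \int[mu]_y (F (x, y))%:E = (lam i)%:E)%E.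
  have := (Phi_orth i i).2; rewrite eqxx => orth.
  transitivity (\int[mu]_x ((lam i)%:E * (Phi i x * Phi i x)%:E))%E.
    apply: ae_eq_integral => //.
    - exact: (measurable_fubini_F intF).
    - apply: (measurable_int mu); apply: integrableZl => //.
      exact: (Phi_orth i i).1.
    - have := eig i; apply: filterS => x hx _; rewrite /= inner hx -!EFinM.
      by congr EFin; ring.
  by rewrite integralZl ?orth ?mule1 //; exact: (Phi_orth i i).1.
have esum_le m := expectation_double_sum_le Xs_meas Xs_law Xs_indep m mF FC Flam.
(* Positive definiteness is tested with the coefficients Phi_i(X_a) on m+1 samples, and the expected
   value is divided by m+1. *)
have lower m : 0 <= C * (M * M) + m%:R * lam i.
  have : (0%:E <= (m.+1%:R * (C * (M * M)) + m.+1%:R * m%:R * lam i)%:E)%E.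
    apply: le_trans (esum_le m.+1); apply: integral_ge0 => w _; rewrite lee_fin.
    have := kpd m.+1 (fun a => Xs a w) (fun a => Phi i (Xs a w)).
    congr (0 <= _); apply: eq_bigr => a _; apply: eq_bigr => b _.
    by rewrite /F mulrC.
  by rewrite lee_fin -mulrA -mulrDr pmulr_rge0 // ltr0n.
rewrite leNgt; apply/negP => lam0.
(* A negative lam_i is contradicted by any m exceeding C M^2 / (- lam_i). *)
have := lower (Num.truncn (C * (M * M) / - lam i)).+1.
have := truncnS_gt (C * (M * M) / - lam i).
rewrite ltr_pdivrMr ?oppr_gt0 // mulrN; lra.
Qed.

End MercerCoefficients.

Theorem theorem1 (R : realType) (X : pointedMetricType R)
  (hcomp : compact [set: X])
  (mu : probability (borelT X) R)
  (k : X -> X -> R) (hk : mercer_kernel k)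
  (lam : nat -> R) (Phi : nat -> X -> R)
  (hPhi_meas : forall i, measurable_fun [set: borelT X] (Phi i : borelT X -> R))
  (hPhi_orth : forall i j,
      mu.-integrable [set: borelT X] (fun x : borelT X => (Phi i x * Phi j x)%:E) /\
      (\int[mu]_x (Phi i x * Phi j x)%:E)%E = (if i == j then 1 else 0)%:E)
  (hPhi_eig : forall i, {ae mu, forall x : borelT X,
      (\int[mu]_z (k x z * Phi i z)%:E)%E = (lam i * Phi i x)%:E})
  (hmercer : forall x z : X,
      (fun N => \sum_(0 <= i < N) lam i * Phi i x * Phi i z) @ \oo --> k x z)
  (g : R -> R) (L : R) (hg0 : forall t, 0 <= g t)
  (hgL : forall s t, `|g s - g t| <= L * `|s - t|)
  (kg : X -> X -> R)
  (hkg : forall x z : X,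
      (fun N => \sum_(0 <= i < N) g (lam i) * Phi i x * Phi i z) @ \oo --> kg x z)
  (hkg_mercer : mercer_kernel kg)
  (M : R) (hM : forall i x, `|Phi i x| <= M)
  (dO : measure_display) (Omega : measurableType dO) (P : probability Omega R)
  (Xs : nat -> Omega -> borelT X)
  (hXs_meas : forall i, measurable_fun [set: Omega] (Xs i))
  (hXs_law : forall i (A : set (borelT X)), measurable A -> P (Xs i @^-1` A) = mu A)
  (hXs_indep : mutually_independent P Xs) :
  {ae P, forall w : Omega,
    forall (V : forall n, 'M[R]_n) (lh : forall n, 'I_n -> R),
      (forall n, eigendecomposition
          (kernel_matrix k (fun i : 'I_n => (Xs i w : X))) (V n) (lh n)) ->
      (fun n => frobenius
          (spectral_modify g (V n) (lh n)
           - kernel_matrix kg (fun i : 'I_n => (Xs i w : X)))) @ \oo --> 0}.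
Proof.
have [C kC] := mercer_kernel_bounded hcomp hk.
have [Cg kgC] := mercer_kernel_bounded hcomp hkg_mercer.
have lam0 := mercer_eigenvalue_ge0 hPhi_meas hPhi_orth hM hXs_meas hXs_law hXs_indep
  hcomp hk hPhi_eig hmercer.
have lamcvg := mercer_coefficients_summable hPhi_orth lam0 (fun x => kC x x) hmercer.
have glamcvg := mercer_coefficients_summable hPhi_orth (fun i => hg0 (lam i))
  (fun x => kgC x x) hkg.
(* Orthonormality centres Phi_i Phi_j - delta_ij, which is bounded by M^2 + 1, so the strong law
   applies. *)
have gram i j : {ae P, forall w, (fun n => n%:R^-1 *
    \sum_(l < n) (Phi i (Xs l w) * Phi j (Xs l w) - (i == j)%:R)) @ \oo --> 0}.
  apply: (strong_law (mu := mu) hXs_meas hXs_law hXs_indep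
    (f := fun x => Phi i x * Phi j x - (i == j)%:R) (B := M * M + 1)).
  - by apply: measurable_funB => //; exact: measurable_funM.
  - move=> x; rewrite (le_trans (ler_normB _ _)) // lerD //.
      by rewrite normrM ler_pM.
    by case: (i == j); rewrite ?normr1 ?normr0.
  - have cstint : mu.-integrable [set: borelT X] (EFin \o cst (i == j)%:R).
      exact: (@bounded_integrable _ _ _ mu _ `|(i == j)%:R|).
    rewrite integralB_EFin //; last exact: (hPhi_orth i j).1.
    rewrite (hPhi_orth i j).2 integral_cst // [X in (_ * X)%E](probability_setT mu).
    by rewrite mule1; case: (i == j); rewrite subee.
(* The pairs (i, j) are countable, so one null set serves them all; off it the argument is
   deterministic and covers every choice of eigenbases. *)
have {}gram := ae_foralln (fun i => ae_foralln (fun j => gram i j)).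
apply: filterS gram => w gram V lh eigV.
exact: (@spectral_modify_cvg R X Phi M hM k kg lam g L (fun l => Xs l w) V lh
  hgL hg0 lam0 lamcvg glamcvg hmercer hkg gram eigV).
Qed.
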